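(* Let $R$ be a ring and let $M$ be a right $R$-module with finite composition length. If $M$ is max-projective, then $M$ is projective.
   Context: Rings are associative with identity; modules are unital right modules. A right $R$-module $M$ is max-projective if for every maximal right ideal $I$ of $R$, every homomorphism $M\to R/I$ factors through the canonical projection $R\to R/I$. *)

(* Defs.v *)
From HB Require Import structures.
From mathcomp Require Import all_boot all_algebra.

Set Implicit Arguments.
Unset Strict Implicit.
Unset Printing Implicit Defensive.

Import GRing.Theory.
Local Open Scope ring_scope.
Local Open Scope quotient_scope.

(* A right R-module is a left module over the converse ring R^c:              *)
(* for a : R, the scaling (a : R^c) *: x stands for x a.                      *)
Notation rmodType R := (lmodType R^c).

(* R as a right module over itself: here (a : R^c) *: x is x * a, computed in *)
(* R, so that the submodules of right_regular R are the right ideals of R.    *)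
Notation right_regular R := ((R^c)^o).

Section QuotientModule.
Variables (R : pzRingType) (V : lmodType R) (N : submodClosed V).

(* submodClosed is stated over semirings and does not inherit from            *)
(* zmodClosed, which Quotient.quot requires.                                       *)
Definition submod_pred : {pred V} := N.

HB.instance Definition _ := GRing.isZmodClosed.Build V submod_pred
  (GRing.submod_closedB (submodClosedP N)).

Definition quotmod : Type := {ideal_quot submod_pred}.

HB.instance Definition _ := GRing.Zmodule.on quotmod.

Definition quotmod_pi (x : V) : quotmod := \pi_({ideal_quot submod_pred}) x.

Definition quotmod_scale (a : R) (u : quotmod) : quotmod :=
  quotmod_pi (a *: repr (u : {ideal_quot submod_pred})).

Lemma quotmod_pi_eq x y : (quotmod_pi x = quotmod_pi y) <-> (x - y \in N).
Proof. by rewrite (Quotient.idealrBE submod_pred); split=> [/eqP|/eqP]. Qed.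

Lemma quotmod_pi_surj (u : quotmod) : exists x, quotmod_pi x = u.
Proof. by exists (repr (u : {ideal_quot submod_pred})); rewrite /quotmod_pi reprK. Qed.

Fact quotmod_pi_is_zmod_morphism : zmod_morphism quotmod_pi.
Proof. by move=> x y; rewrite /quotmod_pi; exact: raddfB. Qed.

HB.instance Definition _ :=
  GRing.isZmodMorphism.Build V quotmod quotmod_pi quotmod_pi_is_zmod_morphism.

Lemma quotmod_scale_pi a x :
  quotmod_scale a (quotmod_pi x) = quotmod_pi (a *: x).
Proof.
apply/quotmod_pi_eq; rewrite -scalerBr rpredZ //.
by apply/quotmod_pi_eq; rewrite /quotmod_pi reprK.
Qed.

Fact quotmod_scalerA a b u :
  quotmod_scale a (quotmod_scale b u) = quotmod_scale (a * b) u.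
Proof.
by have [x <-] := quotmod_pi_surj u; rewrite !quotmod_scale_pi scalerA.
Qed.

Fact quotmod_scale1r : left_id 1 quotmod_scale.
Proof.
by move=> u; have [x <-] := quotmod_pi_surj u; rewrite quotmod_scale_pi scale1r.
Qed.

Fact quotmod_scalerDr : right_distributive quotmod_scale +%R.
Proof.
move=> a u v; have [x <-] := quotmod_pi_surj u.
have [y <-] := quotmod_pi_surj v.
by rewrite -raddfD !quotmod_scale_pi -raddfD scalerDr.
Qed.

Fact quotmod_scalerDl u : {morph quotmod_scale^~ u : a b / a + b}.
Proof.
move=> a b; have [x <-] := quotmod_pi_surj u.
by rewrite !quotmod_scale_pi -raddfD scalerDl.
Qed.

HB.instance Definition _ := GRing.Zmodule_isLmodule.Build R quotmod
  quotmod_scalerA quotmod_scale1r quotmod_scalerDr quotmod_scalerDl.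

Fact quotmod_pi_is_scalable : scalable quotmod_pi.
Proof. by move=> a x; rewrite -quotmod_scale_pi. Qed.

HB.instance Definition _ :=
  GRing.isScalable.Build R V quotmod *:%R quotmod_pi quotmod_pi_is_scalable.

End QuotientModule.

(* Submodules are the boolean predicates of submodClosed; under the classical *)
(* axioms of mathcomp-classical every submodule is of this form.              *)
Section Length.
Variables (R : pzRingType) (V : lmodType R).

Definition proper_sub (A B : {pred V}) : Prop :=
  {subset A <= B} /\ ~ {subset B <= A}.

(* L is a predicate rather than a submodule so that L := predT is the whole   *)
(* module.                                                                    *)
Definition maximal_submodule_in (N : submodClosed V) (L : {pred V}) : Prop :=
  proper_sub N L /\
  forall K : submodClosed V,
    {subset N <= K} -> {subset K <= L} -> K =i N \/ K =i L.

(* 0 = N 0 < N 1 < ... < N n = V, each term a maximal submodule of the next   *)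
(* (so the factors are simple); only the first n + 1 terms of N matter.       *)
Definition composition_series (n : nat) (N : nat -> submodClosed V) : Prop :=
  [/\ forall x, (x \in N 0%N) = (x == 0),
      forall x, x \in N n &
      forall i, (i < n)%N -> maximal_submodule_in (N i) (N i.+1)].

Definition finite_length : Prop := exists n N, composition_series n N.

End Length.

Section MaxProjective.
Variables (R : pzRingType) (M : rmodType R).

Definition maximal_right_ideal (I : submodClosed (right_regular R)) : Prop :=
  maximal_submodule_in I predT.

Definition max_projective : Prop :=
  forall I : submodClosed (right_regular R), maximal_right_ideal I ->
  forall f : {linear M -> quotmod I},
  exists h : {linear M -> right_regular R}, f =1 @quotmod_pi _ _ I \o h.

Definition projective : Prop :=
  forall (A B : rmodType R) (g : {linear A -> B}) (f : {linear M -> B}),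
  (forall b, exists a, g a = b) ->
  exists h : {linear M -> A}, f =1 g \o h.

End MaxProjective.

Arguments finite_length {R} V.
Arguments max_projective {R} M.
Arguments projective {R} M.

(* Main.v *)
From HB Require Import structures.
Require Import Defs.
From mathcomp Require Import all_boot all_algebra.
From mathcomp Require Import boolp.

Set Implicit Arguments.
Unset Strict Implicit.
Unset Printing Implicit Defensive.

Import GRing.Theory.
Local Open Scope ring_scope.

(** Call an endomorphism u of M liftable when f \o u lifts through g for every
surjection g : A -> B and every f : M -> B; M is projective exactly when the
identity is liftable.  Liftable maps are closed under sums and under
precomposition with endomorphisms, and any map y |-> h y *: x with
h : M -> R linear is liftable, because it factors through R.

Let e be a liftable idempotent of M, starting with e = 0.  If e <> 1, then e M
is a proper submodule, so finite length puts it in a maximal submodule N.  Since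
M is generated by e M and (1 - e) M, some x outside N satisfies e x = 0; the
simple module M / N is R / I for I the annihilator of x modulo N, with x mapped
to the class of 1.  Max-projectivity lifts M -> R / I to some h : M -> R, and
then c = h x is congruent to 1 modulo I ([simple_quotient_map]).
Put phi y := h (y - e y) *: x.  Then phi e = e phi = 0 and phi^k x = c^k *: x,
which lies outside N because every power of c is still 1 modulo I.  So phi is a
liftable, non-nilpotent endomorphism of a module of finite length, and by
Fitting's lemma ([fitting_inverse]) the projection p on the image of phi^k, for
large k, is phi^k \o q for some endomorphism q.  It is liftable, nonzero and
orthogonal to e, so e + p is a liftable idempotent whose kernel is strictly
smaller ([larger_liftable_idempotent]).  As lengths are finite, e = 1 is reached.

Finite length enters only through a bounded, strictly monotone function on
submodules ([finite_length_function]).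

Right R-modules being left modules over R^c, everything but the last part is
about left modules over a ring S; for c, d : R^c the product c * d is the
product d c of R. *)

(** * Submodules and linear maps given by propositions *)

Section Submodules.
Variables (S : pzRingType) (V : lmodType S).

Lemma submodB (K : submodClosed V) x y : x \in K -> y \in K -> x - y \in K.
Proof. by have [_] := GRing.submod_closedB (submodClosedP K); apply. Qed.

(** Images and sums of submodules are given by existential statements, so their
membership is not boolean by construction; classically, every linearly closed
proposition has a boolean membership predicate. *)
Definition closed_prop (P : V -> Prop) :=
  P 0 /\ forall a x y, P x -> P y -> P (a *: x + y).

(** The closure proof is an argument so that the submodule structure can be
inferred from the term. *)
Definition comprehension (P : V -> Prop) (_ : closed_prop P) : {pred V} :=
  fun x => `[< P x >].

Fact comprehension_closed P (cP : closed_prop P) :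
  GRing.subsemimod_closed (comprehension cP).
Proof.
case: (cP) => P0 PD; apply: GRing.submod_closed_semi; split.
  exact/asboolP.
by move=> a x y /asboolP Px /asboolP Py; apply/asboolP/PD.
Qed.

HB.instance Definition _ P (cP : closed_prop P) :=
  GRing.isSubmodClosed.Build S V (comprehension cP) (comprehension_closed cP).

Lemma comprehensionP P (cP : closed_prop P) x :
  reflect (P x) (x \in comprehension cP).
Proof. exact: asboolP. Qed.

Lemma add_line_closed (N : submodClosed V) a :
  closed_prop (fun x => exists r, x - r *: a \in N).
Proof.
split=> [|c x y [r xN] [s yN]].
  by exists 0; rewrite scale0r subr0 rpred0.
exists (c * r + s).
suff -> : c *: x + y - (c * r + s) *: a = c *: (x - r *: a) + (y - s *: a).
  by rewrite rpredD ?rpredZ.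
by rewrite scalerBr scalerDl scalerA opprD addrACA.
Qed.

(** The submodule N + S a lies strictly above N and within L, hence equals L. *)
Lemma maximal_submodule_generation (N : submodClosed V) (L : {pred V}) a b :
    GRing.submod_closed L -> maximal_submodule_in N L ->
    a \in L -> a \notin N -> b \in L ->
  exists r, b - r *: a \in N.
Proof.
move=> [_ LP] [[NL _] maxN] aL aN bL.
have [|x||] := maxN (comprehension (add_line_closed N a)) _ _.
- by move=> x xN; apply/comprehensionP; exists 0; rewrite scale0r subr0.
- move=> /comprehensionP[r /NL xL].
  by rewrite -[x](subrK (r *: a)) addrC LP.
- move=> /(_ a); rewrite (negPf aN) => /comprehensionP[].
  by exists 1; rewrite scale1r subrr rpred0.
- by move=> /(_ b); rewrite bL => /comprehensionP.
Qed.

End Submodules.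

(** A submodule of V * W that is the graph of a function is the graph of a
linear map. *)
Section LinearGraph.
Variables (S : pzRingType) (V W : lmodType S) (G : V -> W -> Prop).

Lemma linear_of_graph :
    (forall v, exists w, G v w) ->
    (forall v w w', G v w -> G v w' -> w = w') ->
    (forall a v v' w w', G v w -> G v' w' -> G (a *: v + v') (a *: w + w')) ->
  exists g : {linear V -> W}, forall v, G v (g v).
Proof.
move=> /choice[g gP] uniqG linG.
have lin_g : linear g by move=> a v w; apply: uniqG (gP _) (linG _ _ _ _ _ _ _).
pose gm := GRing.isLinear.Build S V W *:%R g lin_g.
pose gL : {linear V -> W} := HB.pack g gm.
by exists gL.
Qed.

End LinearGraph.

(** * Length and Fitting's lemma *)

Section Iterates.
Variables (S : pzRingType) (V : lmodType S) (phi : {linear V -> V}).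

Fact iter_is_linear k : linear (iter k phi).
Proof. by move=> a x y; elim: k => //= k ->; rewrite linearP. Qed.

HB.instance Definition _ k :=
  GRing.isLinear.Build S V V *:%R (iter k phi) (iter_is_linear k).

Lemma iter_ker_closed k : closed_prop (fun x => iter k phi x = 0).
Proof.
by split=> [|a x y x0 y0]; rewrite ?linear0 // linearP /= x0 y0 scaler0 addr0.
Qed.

Lemma iter_im_closed k : closed_prop (fun y => exists x, y = iter k phi x).
Proof.
split=> [|a _ _ [x ->] [y ->]]; first by exists 0; rewrite linear0.
by exists (a *: x + y); rewrite linearP.
Qed.

End Iterates.

Section LengthFunction.
Variables (S : pzRingType) (V : lmodType S).

(** The only trace of the composition length that is used: ascending and
descending chains of submodules have at most n strict steps. *)
Definition length_function (n : nat) (len : submodClosed V -> nat) : Prop :=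
  (forall K, (len K <= n)%N) /\
  (forall A B : submodClosed V, {subset A <= B} ->
     (len A <= len B)%N /\ ((len B <= len A)%N -> {subset B <= A})).

(** Count the steps N i < N i.+1 of a composition series at which K acquires a
new element.  If A is included in B and both jump at the same steps, then A = B:
by induction on i, an element of B in N i.+1 can be corrected, using an element
of A that generates the simple factor N i.+1 / N i, to one of B in N i. *)
Lemma finite_length_function :
  finite_length V -> exists n len, length_function n len.
Proof.
case=> n [N [N0 Nn maxN]].
pose jump (K : submodClosed V) (i : 'I_n) :=
  exists x, [/\ x \in K, x \in N i.+1 & x \notin N i].
exists n, (fun K => #|[set i | `[< jump K i >]]|); split.
  by move=> K; rewrite -[leqRHS]card_ord max_card.
move=> A B AB.
have jumpAB : [set i | `[< jump A i >]] \subset [set i | `[< jump B i >]].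
  apply/subsetP => i; rewrite !inE => /asboolP[x [xA xN xN']].
  by apply/asboolP; exists x; split; first exact: AB.
split; first exact: subset_leq_card.
move=> leBA; have /eqP eqAB : [set i | `[< jump A i >]] == [set i | `[< jump B i >]].
  by rewrite eqEcard jumpAB.
suff BA i b : (i <= n)%N -> b \in B -> b \in N i -> b \in A.
  by move=> b bB; apply: BA (leqnn n) bB (Nn b).
elim: i b => [|i IHi] b; first by move=> _ _; rewrite N0 => /eqP ->; rewrite rpred0.
move=> lt_in bB bN; have [bNi | bNi] := boolP (b \in N i).
  by apply: IHi bNi => //; apply: ltnW.
have : Ordinal lt_in \in [set i | `[< jump B i >]].
  by rewrite inE; apply/asboolP; exists b.
rewrite -eqAB inE => /asboolP[a [aA aN aNi]].
have [r rN] := maximal_submodule_generation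
  (GRing.subsemimod_closed_submod (submodClosedP (N i.+1))) (maxN i lt_in) aN aNi bN.
rewrite -[b](subrK (r *: a)) rpredD ?rpredZ //.
apply: IHi rN; first exact: ltnW.
by rewrite submodB // rpredZ // AB.
Qed.

Variables (n : nat) (len : submodClosed V -> nat).
Hypothesis lenP : length_function n len.

Lemma length_strict (A B : submodClosed V) x :
  {subset A <= B} -> x \in B -> x \notin A -> (len A < len B)%N.
Proof.
move=> AB xB; apply: contraNltn => leBA.
by have [_] := lenP.2 _ _ AB; apply.
Qed.

(** Enlarge K as long as some submodule avoiding a point lies strictly above
it; this stops because lengths are bounded. *)
Lemma maximal_submodule_above (K : submodClosed V) x :
    x \notin K ->
  exists N : submodClosed V,
    maximal_submodule_in N predT /\ {subset K <= N}.
Proof.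
have [k] := ubnP (n - len K); elim: k K x => // k IHk K x ltk xK.
have [[K' [y [z [KK' yK' yK zK']]]] | noK] := EM (exists (K' : submodClosed V) y z,
    [/\ {subset K <= K'}, y \in K', y \notin K & z \notin K']).
  have [||N [maxN K'N]] := IHk K' z; last by exists N; split=> // u /KK' /K'N.
    have lt_len := length_strict KK' yK' yK.
    apply: leq_trans (ltn_sub2l _ lt_len) ltk.
    exact: leq_trans lt_len (lenP.1 _).
  by [].
exists K; split=> //; split.
  by split=> // /(_ x isT); apply/negP.
move=> K' KK' _; have [/(_ _)K'K | nK'K] := EM {subset K' <= K}.
  by left=> u; apply/idP/idP => [/K'K|/KK'].
right=> z; apply/idP; apply/negPn/negP => zK'; apply: nK'K => y yK'.
by apply/negPn/negP => yK; apply: noK; exists K', y, z.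
Qed.

(** The kernels of the powers of phi increase and their images decrease, so both
become constant. *)
Lemma fitting_index (phi : {linear V -> V}) :
  exists k, forall j, (k <= j)%N ->
    (forall x, iter j phi x = 0 -> iter k phi x = 0) /\
    (forall x, exists y, iter k phi x = iter j phi y).
Proof.
pose ker k : submodClosed V := comprehension (iter_ker_closed phi k).
pose im k : submodClosed V := comprehension (iter_im_closed phi k).
have kerS k j : (k <= j)%N -> {subset ker k <= ker j}.
  move=> kj x /comprehensionP x0; apply/comprehensionP.
  by rewrite -(subnK kj) iterD x0 linear0.
have imS k j : (k <= j)%N -> {subset im j <= im k}.
  move=> kj x /comprehensionP[y ->]; apply/comprehensionP.
  by exists (iter (j - k) phi y); rewrite -iterD subnKC.
(* Both chains are controlled at once by g, which is monotone and bounded; they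
   are constant from any index where g is maximal. *)
pose g k := (len (ker k) + (n - len (im k)))%N.
have gP : exists m, `[< exists k, g k = m >] by exists (g 0%N); apply/asboolP; exists 0%N.
have g_le m : `[< exists k, g k = m >] -> (m <= n + n)%N.
  by move=> /asboolP[k <-]; rewrite leq_add ?leq_subr ?lenP.1.
case: (ex_maxnP gP g_le) => _ /asboolP[k <-] g_max.
exists k => j kj; have := g_max (g j); rewrite asboolT; last by exists j.
move=> /(_ isT) le_g.
have [le_ker ker_eq] := lenP.2 _ _ (kerS _ _ kj).
have [le_im im_eq] := lenP.2 _ _ (imS _ _ kj).
have := lenP.1 (im k); have := lenP.1 (im j) => le1 le2.
have le_co : (n - len (im k) <= n - len (im j))%N by exact: leq_sub2l.
have le_ker' : (len (ker j) <= len (ker k))%N.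
  rewrite -(leq_add2r (n - len (im j))).
  by apply: leq_trans le_g _; rewrite leq_add2l.
have le_im' : (len (im k) <= len (im j))%N.
  rewrite -(leq_sub2lE _ le2) -(leq_add2l (len (ker j))).
  by apply: leq_trans le_g _; rewrite leq_add2r.
split=> x.
  move=> x0; apply/(comprehensionP (iter_ker_closed phi k))/(ker_eq le_ker').
  exact/comprehensionP.
apply/(comprehensionP (iter_im_closed phi j))/im_eq => //.
by apply/comprehensionP; exists x.
Qed.

(** With theta = phi ^ k.+1 for large k, V is the direct sum of the image and
the kernel of theta; q is the inverse of theta on the former and 0 on the latter.
The two equations say that theta \o q is the projection on the image.  The
exponent k.+1 leaves a factor phi in theta, which makes theta liftable below. *)
Lemma fitting_inverse (phi : {linear V -> V}) :
  exists k (q : {linear V -> V}), let theta := iter k.+1 phi in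
    (forall x, theta (theta (q x)) = theta x) /\
    (forall x, theta x = 0 -> q x = 0).
Proof.
have [k stable] := fitting_index phi; pose theta := iter k.+1 phi.
have thetaP : linear theta by exact: iter_is_linear.
have thetaB x y : theta (x - y) = theta x - theta y by exact: linearB.
have theta3 x : theta (theta (theta x)) = iter (k.+1 + k.+1 + k.+1) phi x.
  by rewrite !iterD.
have [|ker_stable im_stable] := stable (k.+1 + k.+1 + k.+1)%N.
  by apply: leq_trans (leqnSn k) _; rewrite -addnA leq_addr.
have ker3 x : theta (theta (theta x)) = 0 -> theta x = 0.
  by rewrite theta3 => /ker_stable x0; rewrite /theta iterS x0 linear0.
(* theta is bijective on its image, so v is theta w plus an element of the kernel
   for a unique w = theta z in the image; this w is q v, and the equation is
   theta (theta w) = theta v. *)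
pose G v w := exists z, theta (theta (theta z)) = theta v /\ w = theta z.
have [v|v w w'|a v v' w w'|q qP] := @linear_of_graph S V V G.
- have [z zv] := im_stable (phi v); exists (theta z), z; split=> //.
  by rewrite theta3 -zv /theta iterSr.
- move=> [z [zv ->]] [z' [zv' ->]]; apply/eqP; rewrite -subr_eq0 -thetaB.
  by apply/eqP/ker3; rewrite !thetaB zv zv' subrr.
- move=> [z [zv ->]] [z' [zv' ->]]; exists (a *: z + z').
  by rewrite !thetaP zv zv'.
exists k, q; split=> x; have [z [zx ->]] := qP x; first exact: zx.
by move=> x0; apply: ker3; rewrite zx.
Qed.

End LengthFunction.

(** * Liftable endomorphisms *)

Section Liftable.
Variables (S : pzRingType) (M : lmodType S).

Definition liftable (u : M -> M) : Prop :=
  forall (A B : lmodType S) (g : {linear A -> B}) (f : {linear M -> B}),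
  (forall b, exists a, g a = b) ->
  exists h : {linear M -> A}, forall x, g (h x) = f (u x).

Lemma liftable0 : liftable (fun _ => 0).
Proof. by move=> A B g f _; exists \0 => x; rewrite !linear0. Qed.

Lemma liftableD u v :
  liftable u -> liftable v -> liftable (fun x => u x + v x).
Proof.
move=> lu lv A B g f surj.
have [[h hP] [h' h'P]] := (lu A B g f surj, lv A B g f surj).
by exists (h \+ h') => x; rewrite /= !linearD hP h'P.
Qed.

Lemma liftable_comp (u : M -> M) (v : {linear M -> M}) :
  liftable u -> liftable (u \o v).
Proof.
move=> lu A B g f surj; have [h hP] := lu A B g f surj.
by exists (h \o v) => x; rewrite /= hP.
Qed.

(** Such a map factors through S, which is free: only m has to be lifted. *)
Lemma liftable_scale (h : {linear M -> S^o}) (m : M) :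
  liftable (fun x => (h x : S) *: m).
Proof.
move=> A B g f surj; have [a ga] := surj (f m).
have lin_h : linear (fun x => (h x : S) *: a).
  by move=> c x y; rewrite linearP scalerDl scalerA.
pose hm := GRing.isLinear.Build S M A *:%R _ lin_h.
pose hL : {linear M -> A} := HB.pack (fun x => (h x : S) *: a) hm.
by exists hL => x; rewrite /= !linearZ ga.
Qed.

End Liftable.

(** * Simple quotients as quotients of the ring *)

Section ColonIdeal.
Variables (S : pzRingType) (V : lmodType S) (N : submodClosed V) (x : V).

Lemma colon_closed : @closed_prop S S^o (fun r => (r : S) *: x \in N).
Proof.
split=> [|a r s rN sN]; first by rewrite scale0r rpred0.
by rewrite scalerDl -scalerA rpredD // rpredZ.
Qed.

Definition colon : submodClosed (S^o) := comprehension colon_closed.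

Hypotheses (maxN : maximal_submodule_in N predT) (xN : x \notin N).

Lemma maximal_generation a y : a \notin N -> exists r, y - r *: a \in N.
Proof. by move=> aN; apply: maximal_submodule_generation maxN _ aN _. Qed.

(** If r is not in the colon ideal, then r x generates V modulo N, so x is
t r x modulo N for some t and 1 - t r is in the colon ideal. *)
Lemma maximal_colon : maximal_submodule_in colon predT.
Proof.
split.
  split=> // /(_ 1 isT) /comprehensionP.
  by rewrite scale1r (negPf xN).
move=> K IK _; have [KI | nKI] := EM {subset K <= colon}.
  by left=> r; apply/idP/idP => [/KI|/IK].
right=> s; apply/idP; apply/negPn/negP => sK; apply: nKI => r rK.
apply/comprehensionP/negPn/negP => rxN.
have [t tN] := maximal_generation x rxN.
have K1 : 1 - t * r \in K.
  by apply/IK/comprehensionP; rewrite scalerBl scale1r -scalerA.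
have split1 (u v w : S) : u = u * (1 - v * w) + (u * v) * w.
  by rewrite mulrBr mulr1 mulrA subrK.
have := rpredD (rpredZ s K1) (rpredZ (s * t) rK).
rewrite -[X in X \in K]/(s * (1 - t * r) + (s * t) * r : S) -split1.
exact/negP.
Qed.

(** The isomorphism of V / N with S / (N : x) that sends the class of r x to the
class of r, composed with the projection of V on V / N. *)
Lemma simple_quotient_map :
  exists f : {linear V -> quotmod colon},
    f x = quotmod_pi colon 1 /\ (forall y, y \in N -> f y = 0).
Proof.
pose G y (u : quotmod colon) :=
  exists r, y - r *: x \in N /\ u = quotmod_pi colon r.
have Guniq v w w' : G v w -> G v w' -> w = w'.
  move=> [r [rN ->]] [s [sN ->]]; apply/quotmod_pi_eq/comprehensionP.
  rewrite scalerBl; suff -> : r *: x - s *: x = (v - s *: x) - (v - r *: x).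
    exact: submodB.
  by rewrite opprB [RHS]addrC addrA subrK.
have [v|a v v' w w'|f fP] := linear_of_graph _ Guniq.
- by have [r rN] := maximal_generation v xN; exists (quotmod_pi colon r), r.
- move=> [r [rN ->]] [s [sN ->]]; exists (a * r + s); split.
    suff -> : a *: v + v' - (a * r + s) *: x = a *: (v - r *: x) + (v' - s *: x).
      by rewrite rpredD ?rpredZ.
    by rewrite scalerBr scalerDl scalerA opprD addrACA.
  by rewrite -linearP.
exists f; split=> [|y yN]; apply: Guniq (fP _) _.
  by exists 1; rewrite scale1r subrr rpred0.
by exists 0; rewrite scale0r subr0 linear0.
Qed.

End ColonIdeal.

(** * Max-projective modules of finite length *)

Section MaxProjectiveFiniteLength.
Variables (R : pzRingType) (M : rmodType R) (n : nat).
Variable len : submodClosed M -> nat.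
Hypotheses (lenP : length_function n len) (maxM : max_projective M).

(** The new idempotent is e + p, where p projects on the stable image of the
non-nilpotent map y |-> hd y *: x built from a simple quotient of M killing the
image of e. *)
Lemma larger_liftable_idempotent (e : {linear M -> M}) x0 :
    (forall x, e (e x) = e x) -> liftable e -> e x0 != x0 ->
  exists e' : {linear M -> M},
    [/\ forall x, e' (e' x) = e' x, liftable e',
        forall x, e' x = 0 -> e x = 0 & exists2 x, e x = 0 & e' x != 0].
Proof.
move=> ee le ex0.
have im_closed : closed_prop (fun y => e y = y).
  by split=> [|a x y ex ey]; rewrite ?linear0 // linearP /= ex ey.
pose im_e : submodClosed M := comprehension im_closed.
have [|N [maxN eN]] := maximal_submodule_above (x := x0) lenP (K := im_e).
  by apply/comprehensionP/eqP.
have eNx y : e y \in N by apply/eN/comprehensionP.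
have [x xN ex] : exists2 x, x \notin N & e x = 0.
  have [[_ nN] _] := maxN.
  have [y yN] : exists y, y \notin N.
    have [//|no] := EM (exists y, y \notin N); case: nN => y _.
    by apply/negPn/negP => yN; apply: no; exists y.
  exists (y - e y); last by rewrite linearB ee subrr.
  by apply: contraNN yN => yN; rewrite -[y](subrK (e y)) rpredD.
have [f [fx fN]] := simple_quotient_map maxN xN.
have [h hP] := maxM (maximal_colon maxN xN) f.
(* h need not vanish on the image of e, but f does; h \o d is the lift of f
   that vanishes there. *)
pose d : {linear M -> M} := idfun \- e.
pose hd : {linear M -> right_regular R} := h \o d.
pose phi_fun y := (hd y : R^c) *: x.
have phi_lin : linear phi_fun.
  by move=> c y z; rewrite /phi_fun linearP scalerDl scalerA.
pose phi : {linear M -> M} :=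
  HB.pack phi_fun (GRing.isLinear.Build R^c M M *:%R phi_fun phi_lin).
have phi_e y : phi (e y) = 0.
  by rewrite /= /phi_fun /hd /= ee subrr linear0 scale0r.
have e_phi y : e (phi y) = 0 by rewrite /= /phi_fun linearZ /= ex scaler0.
pose c : R^c := h x.
have c1 : (1 - c : right_regular R) \in colon N x.
  by apply/quotmod_pi_eq; rewrite -fx hP.
(* All powers of c are 1 modulo the colon ideal, so c is not nilpotent. *)
have cI k : (1 - c ^+ k : right_regular R) \in colon N x.
  elim: k => [|k IHk]; first by rewrite expr0 subrr rpred0.
  suff -> : 1 - c ^+ k.+1 = (1 - c ^+ k) + c ^+ k * (1 - c).
    by rewrite rpredD //; apply: (rpredZ (c ^+ k)).
  by rewrite mulrBr mulr1 -exprSr addrA subrK.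
have phi_x k : iter k phi x = c ^+ k *: x.
  elim: k => [|k IHk]; first by rewrite expr0 scale1r.
  by rewrite iterS IHk /= /phi_fun linearZ /= /hd /= ex subr0 exprSr.
have phi_x_neq0 k : iter k phi x != 0.
  apply: contraNneq xN => phi0; have /comprehensionP := cI k.
  by rewrite scalerBl scale1r -phi_x phi0 subr0.
have [k [q [qP q0]]] := fitting_inverse lenP phi.
set theta := iter k.+1 phi in qP q0.
pose p : {linear M -> M} := iter k.+1 phi \o q.
have pE y : p y = theta (q y) by [].
have thetaB y z : theta (y - z) = theta y - theta z by exact: linearB.
have theta_p y : theta (p y) = theta y by rewrite pE qP.
have pp y : p (p y) = p y.
  rewrite [LHS]pE; suff -> : q (p y) = q y by [].
  apply/eqP; rewrite -subr_eq0 -linearB; apply/eqP/q0.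
  by rewrite thetaB theta_p subrr.
have pe y : p (e y) = 0.
  have th0 : theta (e y) = 0 by rewrite /theta iterSr phi_e linear0.
  by rewrite pE q0 // /theta linear0.
have ep y : e (p y) = 0 by rewrite pE /theta iterS e_phi.
pose e' : {linear M -> M} := e \+ p.
have e'E y : e' y = e y + p y by [].
exists e'; split.
- by move=> y; rewrite !e'E !linearD ee ep pe pp addr0 add0r.
- apply: liftableD => //.
  exact: (liftable_comp (iter k phi \o q) (liftable_scale hd x)).
- move=> y /(congr1 e); rewrite e'E linearD ee ep addr0 linear0.
  by [].
- exists x => //; rewrite e'E ex add0r.
  apply: contraNneq (phi_x_neq0 k.+1) => px.
  by rewrite -/theta -theta_p px /theta linear0.
Qed.

(** Each enlargement strictly shrinks the kernel, so that the length of the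
kernel decreases until the idempotent is the identity. *)
Lemma liftable_identity : liftable (@id M).
Proof.
suff climb (e : {linear M -> M}) :
    (forall x, e (e x) = e x) -> liftable e -> liftable (@id M).
  apply: (climb \0) => [x|]; [by [] | exact: liftable0].
have ker_closed (u : {linear M -> M}) : closed_prop (fun x => u x = 0).
  by split=> [|a x y x0 y0]; rewrite ?linear0 // linearP /= x0 y0 scaler0 addr0.
have [m] := ubnP (len (comprehension (ker_closed e))).
elim: m e => // m IHm e ltm ee le.
have [[x ex]|e_id] := EM (exists x, e x != x).
  have [e' [e'e' le' kerS [y ey e'y]]] := larger_liftable_idempotent ee le ex.
  apply: (IHm e') => //; apply: leq_trans _ (ltm : (_ <= m)%N).
  apply: (length_strict lenP (x := y)).
  - by move=> z /comprehensionP /kerS ez; apply/comprehensionP.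
  - exact/comprehensionP.
  - by apply: contraNN e'y => /comprehensionP ->.
move=> A B g f /(le A B g f)[h hP]; exists h => x; rewrite hP.
suff -> : e x = x by [].
by apply/eqP/negPn/negP => ex; apply: e_id; exists x.
Qed.

End MaxProjectiveFiniteLength.

Theorem corollary3 (R : pzRingType) (M : rmodType R) :
  finite_length M -> max_projective M -> projective M.
Proof.
move=> /finite_length_function[n [len lenP]] maxM A B g f surj.
have [h hP] := liftable_identity lenP maxM f surj.
by exists h => x; rewrite /= hP.
Qed.
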